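(* Let $G$ be a modular abelian independence group. Then $G$ has the matching property if and only if $G$ has no submonoid $H$ such that $$1<\rho(H)<\rho(G)\qquad\text{and}\qquad \rho(H)<\infty.$$
   Context: A finitary matroid is a pair $(E,\mathcal{I})$ consisting of a set $E$ and a nonempty collection $\mathcal{I}$ of subsets of $E$ (called the independent sets) such that: (I1) if $A\in\mathcal{I}$ and $B\subseteq A$ then $B\in\mathcal{I}$; (I2) if $A,B$ are finite elements of $\mathcal{I}$ with $|B|=|A|+1$, then there is $x\in B\setminus A$ with $\{x\}\cup A\in\mathcal{I}$; (I3) if $A\subseteq E$ and every finite subset of $A$ belongs to $\mathcal{I}$, then $A\in\mathcal{I}$. The collection $\mathcal{I}$ is called an independence structure on $E$. A basis of a subset $A\subseteq E$ is an inclusion-maximal independent subset of $A$; any two bases of $A$ have the same cardinality, and the rank $\rho(A)$ is that cardinal number; $A$ has finite rank, written $\rho(A)<\infty$, if $\rho(A)$ is a nonnegative integer. An element $x\in E$ depends on $A\subseteq E$ if either $x\in A$, or $x\notin A$ and $\{x\}\cup B\notin\mathcal{I}$ for some independent $B\subseteq A$. The closure is $\operatorname{cl}(A)=\{x\in E: x\text{ depends on }A\}$, and $A$ is a flat if $\operatorname{cl}(A)=A$. The finitary matroid is modular if $\rho(A)+\rho(B)=\rho(A\cup B)+\rho(A\cap B)$ (as cardinals) for all flats $A,B$. An independence group is a group $G$ (written multiplicatively, with identity $1$) together with an independence structure $\mathcal{I}$ on the set $G$ such that for every $g\in G$ and $A\subseteq G$ one has $gA\in\mathcal{I}$ if and only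 if $A\in\mathcal{I}$, where $gA=\{gx:x\in A\}$. A modular abelian independence group is an independence group that is modular as a finitary matroid and whose group is abelian. A submonoid of $G$ is a subset containing $1$ and closed under multiplication. Let $A,B$ be subsets of $G$ with $\rho(A)=\rho(B)$ finite. $A$ is matched to $B$ if for every basis $\mathcal{A}$ of $A$ and every basis $\mathcal{B}$ of $B$ there exists a bijection $f:\mathcal{A}\to\mathcal{B}$ such that $af(a)\notin A$ for all $a\in\mathcal{A}$. The independence group $G$ has the matching property if for every pair $(A,B)$ of finite-rank flats of $G$ with $\rho(A)=\rho(B)$ and $1\notin B$, $A$ is matched to $B$. *)

(* Defs.v *)
From mathcomp Require Import all_boot.
From mathcomp Require Import boolp classical_sets functions cardinality.

Set Implicit Arguments.
Unset Strict Implicit.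
Unset Printing Implicit Defensive.

Local Open Scope classical_set_scope.
Local Open Scope card_scope.
Local Open Scope group_scope.

(* Cardinal numbers are represented by sets, possibly of different types,
   compared with [#=] and [#<=]. *)

Definition card_lt (T U : Type) (A : set T) (B : set U) : Prop :=
  A #<= B /\ ~ (B #<= A).

(* The sum of two cardinals is the cardinal of the disjoint union. *)
Definition card_add (T U : Type) (A : set T) (B : set U) : set (T + U) :=
  (inl @` A) `|` (inr @` B).

Section FinitaryMatroid.
Context {E : Type}.
Implicit Types (I : set (set E)) (A B C : set E) (x : E).

Record independence_structure I : Prop := IndependenceStructure {
  indep_nonempty : I !=set0;
  indep_subset : forall A B, I A -> B `<=` A -> I B;
  indep_augment : forall (n : nat) A B, I A -> I B ->
    A #= `I_n -> B #= `I_n.+1 -> exists2 x, (B `\` A) x & I (x |` A);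
  indep_finitary : forall A,
    (forall B, B `<=` A -> finite_set B -> I B) -> I A
}.

Definition basis I A B : Prop :=
  [/\ B `<=` A, I B & forall C, I C -> C `<=` A -> B `<=` C -> C = B].

(* All bases of A being equipotent, the cardinal number rho(A) is represented
   by an arbitrary one of them; only its cardinality is meaningful. The default
   value is never used, by [basis_rank]. *)
Definition rank I A : set E := xget set0 (basis I A).

Definition finite_rank I A : Prop := finite_set (rank I A).

Definition depends I A x : Prop :=
  A x \/ ~ A x /\ exists B, [/\ B `<=` A, I B & ~ I (x |` B)].

Definition closure I A : set E := [set x | depends I A x].

Definition flat I A : Prop := closure I A = A.

Definition modular I : Prop := forall A B, flat I A -> flat I B ->
  card_add (rank I A) (rank I B)
    #= card_add (rank I (A `|` B)) (rank I (A `&` B)).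

Lemma basis_rank I A : independence_structure I -> basis I A (rank I A).
Proof.
move=> mI; rewrite /rank; apply: xgetPex.
have I0 : I set0.
  by case: (indep_nonempty mI) => B IB; apply: (indep_subset mI IB).
have [|B [[IB BA] maxB]] := @Zorn_bigcup E [set B | I B /\ B `<=` A].
  move=> F FP Ftot; split; last by move=> x [X /FP[_ XA] /XA].
  apply: (indep_finitary mI) => C CF fC.
  have [F0|/set0P[X0 FX0]] := eqVneq F set0.
    by move: CF; rewrite F0 bigcup_set0 subset0 => ->.
  have /finite_setP[N /card_set_bijP[g [gC g_inj _]]] := fC.
  suff [X] : exists2 X, F X & forall x, C x -> (g x < N)%N -> X x.
    move=> FX CX; have [IX _] := FP _ FX; apply: (indep_subset mI IX) => x Cx.
    by apply: CX => //; apply: gC.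
  elim: N {gC} => [|n [X FX CX]]; first by exists X0.
  have [[c Cc gc]|noc] := pselect (exists2 c, C c & g c = n); last first.
    exists X => // x Cx; rewrite ltnS leq_eqVlt => /predU1P[gx|/CX]; last exact.
    by case: noc; exists x.
  have cx x : C x -> g x = n -> x = c.
    by move=> Cx gx; apply: g_inj; rewrite ?inE ?gx.
  have [Y FY Yc] := CF _ Cc.
  have [XY|YX] := Ftot _ _ FX FY; [exists Y|exists X] => // x Cx;
    rewrite ltnS leq_eqVlt => /predU1P[/(cx _ Cx)-> //|/CX Xx].
  - exact/XY/Xx.
  - exact: YX.
  - exact: Xx.
exists B; split=> // C IC CA BC; apply: contrapT => CB.
by apply: (maxB C) => //; split=> // /(conj BC)/seteqP /esym.
Qed.

End FinitaryMatroid.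

Section IndependenceGroup.
Context {G : groupType}.
Implicit Types (I : set (set G)) (A B H : set G).

Record independence_group I : Prop := IndependenceGroup {
  independence_group_structure : independence_structure I;
  independence_group_translate : forall (g : G) A,
    I [set g * x | x in A] <-> I A
}.

Definition modular_abelian_independence_group I : Prop :=
  [/\ independence_group I, modular I & forall x y : G, x * y = y * x].

Definition submonoid H : Prop := monoid_closed [in H].

(* Only meaningful when rho(A) = rho(B) is finite. *)
Definition matched I A B : Prop := forall bA bB, basis I A bA -> basis I B bB ->
  exists2 f : G -> G, set_bij bA bB f & forall a, bA a -> ~ A (a * f a).

Definition matching_property I : Prop := forall A B,
  flat I A -> flat I B -> finite_rank I A -> finite_rank I B ->
  rank I A #= rank I B -> ~ B 1 -> matched I A B.

End IndependenceGroup.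

(* Main.v *)
Require Import Defs.
From mathcomp Require Import all_boot.
From mathcomp Require Import boolp classical_sets functions cardinality.

(** If H is a submonoid with 1 < rho(H) < rho(G) and rho(H) finite, its closure
    C is again closed under multiplication, because translations commute with
    closure ([closure_mul_sub]).  Complete 1 to a basis D of H, replace 1 in D
    by some g outside C, and let B be the flat spanned by the result.  Then C
    and B have the same rank and B avoids 1, but an element of D other than 1
    is a common basis element of C and B, so that any product of an element
    of C with it stays in C: C is not matched to B
    ([no_matching_of_submonoid]).

    Conversely, let A and B be flats of rank n with 1 outside B.  By Hall's
    marriage theorem ([hall_marriage]) a matching of two bases can only fail to
    exist if there are a nonempty set S of basis elements of A and a set T of
    basis elements of B with S T contained in A and |S| + |T| > n.  Adding 1 to
    T and taking closures gives flats V and W with 1 in W, V W contained in A,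
    and rho(V) + rho(W) > n + 1.  This is excluded by a Cauchy-Davenport
    inequality for flats ([product_rank_leq]): if no submonoid of rank at most
    rho(A) has rank greater than 1, then V W contained in A and 1 in W force
    rho(V) + rho(W) <= rho(A) + 1.  The inequality is proved with Dyson's
    e-transform: for e in V replace (V, W) by the closure of V u eW and by the
    intersection of W with e^-1 V.  Modularity says that the sum of the ranks
    is unchanged, commutativity that the product still lies in A, so that one
    can induct on rho(W).  If no transform shrinks W, then V W is contained in
    V, and the stabilizer {h | V h contained in V} is a submonoid of rank at
    least rho(W) and at most rho(V); hence rho(W) <= 1, where the inequality
    is clear.  Finally, a submonoid H with 1 < rho(H) <= n satisfies
    rho(H) < rho(G), because 1 together with a basis of B is an independent
    set with n + 1 elements. *)

Set Implicit Arguments.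
Unset Strict Implicit.
Unset Printing Implicit Defensive.

Local Notation closure := Defs.closure.

(** * Finite cardinals *)

Section FiniteCardinals.
Local Open Scope classical_set_scope.
Local Open Scope card_scope.
Context {E : Type}.
Implicit Types (A B C : set E) (x : E).

Lemma card_setU1 A x n : ~ A x -> A #= `I_n -> x |` A #= `I_n.+1.
Proof.
move=> Ax An; apply/eq_cardSP; exists x; first by left.
by rewrite setUC setUDK// => y [/= -> /Ax].
Qed.

Lemma card_set0_II A : A #= `I_0 -> A = set0.
Proof. by rewrite II0 card_eq0 => /eqP. Qed.

Lemma card_subset_leq A B n m : A `<=` B -> A #= `I_n -> B #= `I_m -> n <= m.
Proof.
move=> /subset_card_le AB An Bm; rewrite -card_le_II.
by rewrite -(card_le_eql An) -(card_le_eqr Bm).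
Qed.

Lemma card_subset_eq A B n : A `<=` B -> A #= `I_n -> B #= `I_n -> A = B.
Proof.
move=> AB An Bn; apply/seteqP; split=> // x Bx; apply: contrapT => Ax.
have /card_subset_leq : x |` A `<=` B by move=> y [->|/AB].
by move=> /(_ _ _ (card_setU1 Ax An) Bn); rewrite ltnn.
Qed.

Lemma card_le_subset A k : `I_k #<= A -> exists2 B, B `<=` A & B #= `I_k.
Proof.
case: k => [|k]; first by exists set0; rewrite ?II0.
elim/Ppointed: E A => [T|T] A.
  by rewrite card_le_emptyr => /eqP/seteqP[/(_ 0 isT)].
move=> /pcard_leP[f]; exists (f @` `I_k.+1); last exact: card_image.
by move=> _ [x kx <-]; exact: funS.
Qed.

Lemma infinite_card_le A k : infinite_set A -> `I_k #<= A.
Proof. by move=> /infiniteP; apply: card_le_trans; exact: card_leT. Qed.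

Lemma enum_card_II A n : A #= `I_n ->
  exists2 a : 'I_n -> E, injective a & range a = A.
Proof.
case: n => [/card_set0_II ->|n].
  have a : 'I_0 -> E by case.
  by exists a; [case|apply/seteqP; split=> // x [[]]].
rewrite card_eq_sym => nA.
have {nA} := card_eq_trans (card_esym (@card_II n.+1)) nA.
elim/Ppointed: E A => [T|T] A.
  by rewrite card_eq_emptyr => /eqP/seteqP[/(_ ord0 Logic.I)].
move=> /card_set_bijP[a [aA ainj asurj]]; exists a.
  by move=> i j; apply: ainj; rewrite inE.
by apply/seteqP; split => // _ [i _ <-]; exact: aA.
Qed.

Lemma card_image_finset (S : finType) (X : {set S}) (a : S -> E) :
  injective a -> a @` [set` X] #= `I_#|X|.
Proof.
move=> ainj; rewrite (card_eql (inj_card_eq _)); last by move=> x y _ _ /ainj.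
have -> : [set` X] = range (fun i : 'I_#|X| => enum_val i).
  apply/seteqP; split=> [x Xx|_ [i _ <-]]; last exact: enum_valP.
  by exists (enum_rank_in Xx x); rewrite ?enum_rankK_in.
rewrite (card_eql (inj_card_eq _)); last by move=> x y _ _ /enum_val_inj.
by rewrite card_eq_sym card_II.
Qed.

End FiniteCardinals.

Section CardAdd.
Local Open Scope classical_set_scope.
Local Open Scope card_scope.

Lemma card_add_II (T U : Type) (A : set T) (B : set U) a b :
  A #= `I_a -> B #= `I_b -> card_add A B #= `I_(a + b).
Proof.
move=> Aa; elim: b B => [|b IHb] B Bb.
  rewrite /card_add (card_set0_II Bb) image_set0 setU0 addn0.
  by rewrite (card_eq_trans _ Aa)// inj_card_eq// => x y _ _ [].
have /eq_cardSP[x Bx /IHb {}IHb] := Bb; rewrite addnS.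
suff -> : card_add A B = inr x |` card_add A (B `\ x).
  by apply: card_setU1 => // -[[y _ //]|[y [By +]]] [yx]; apply.
rewrite /card_add -{1}(setD1K Bx) image_setU image_set1.
by rewrite setUCA.
Qed.

End CardAdd.

(** * Hall's marriage theorem *)

Section Hall.
Context {S T : finType}.
Implicit Types (N : S -> {set T}) (A X Y : {set S}) (M : {set T}).

Lemma bigcup_subU N M Y :
  \bigcup_(x in Y) N x \subset M :|: \bigcup_(x in Y) (N x :\: M).
Proof.
apply/bigcupsP => x Yx; apply/fintype.subsetP => t Nt; rewrite inE.
have [//|tM] := boolP (t \in M); apply/bigcupP; exists x => //.
by rewrite inE tM.
Qed.

(** The Halmos-Vaughan induction on #|A|.  If a nonempty proper subset X of A
    is tight, X and A :\: X are matched separately, the latter outside the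
    neighbourhood of X; otherwise any choice for one element of A leaves
    Hall's condition intact.  The function [f0] supplies values outside A. *)
Lemma hall_marriage N (f0 : S -> T) A :
    (forall X, X \subset A -> #|X| <= #|\bigcup_(x in X) N x|) ->
  exists2 f : S -> T, {in A &, injective f} & {in A, forall x, f x \in N x}.
Proof.
have [n] := ubnP #|A|; elim: n => // n IHn in N A *; rewrite ltnS => An hallA.
have [->|/set0Pn[a aA]] := eqVneq A finset.set0.
  by exists f0 => x; rewrite inE.
have [[X [XA X0 XnA tightX]]|noX] := pselect (exists X : {set S},
  [/\ X \subset A, X != finset.set0, X != A & #|\bigcup_(x in X) N x| <= #|X|]).
  pose M := \bigcup_(x in X) N x.
  have XpA : X \proper A by rewrite finset.properEneq XnA.
  have [|Y YX|f1 f1inj f1N] := IHn N X.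
  - exact: leq_trans (proper_card XpA) An.
  - exact: hallA (fintype.subset_trans YX XA).
  have [|Y YAX|f2 f2inj f2N] := IHn (fun x => N x :\: M) (A :\: X).
  - apply: leq_trans An; rewrite cardsD (finset.setIidPr XA) ltn_subrL.
    by rewrite card_gt0 X0 card_gt0; apply/set0Pn; exists a.
  - move: YAX; rewrite subsetD => /andP[YA YX].
    rewrite -(leq_add2l #|X|).
    have <- : #|X :|: Y| = #|X| + #|Y|.
      by apply/eqP; rewrite leq_card_setU disjoint_sym.
    have /hallA/leq_trans-> // : X :|: Y \subset A by rewrite finset.subUset XA.
    rewrite finset.bigcup_setU -/M; apply: leq_trans (leq_add tightX (leqnn _)).
    apply: leq_trans (leq_card_setU _ _); apply: subset_leq_card.
    by rewrite finset.subUset finset.subsetUl bigcup_subU.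
  have f1M x : x \in X -> f1 x \in M.
    by move=> Xx; apply/bigcupP; exists x => //; exact: f1N.
  have f2M x : x \in A -> x \notin X -> f2 x \in N x :\: M.
    by move=> Ax Xx; apply: f2N; rewrite inE Xx.
  exists (fun x => if x \in X then f1 x else f2 x) => [x y Ax Ay|x Ax].
    have [Xx|Xx] := boolP (x \in X); have [Xy|Xy] := boolP (y \in X).
    - exact: f1inj.
    - by move=> f12; move: (f2M _ Ay Xy); rewrite -f12 inE f1M.
    - by move=> f21; move: (f2M _ Ax Xx); rewrite f21 inE f1M.
    - by apply: f2inj; rewrite inE ?Xx ?Xy.
  have [/f1N//|Xx] := boolP (x \in X).
  by have := f2M _ Ax Xx; rewrite inE => /andP[].
have [t Nat] : exists t, t \in N a.
  apply/set0Pn; rewrite -card_gt0; have := hallA [set a].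
  by rewrite finset.sub1set aA cards1 big_set1; apply.
have [|Y YA|f finj fN] := IHn (fun x => N x :\: [set t]) (A :\ a).
- by apply: leq_trans An; rewrite [X in _ < X](cardsD1 a) aA.
- have [->|Y0] := eqVneq Y finset.set0; first by rewrite cards0.
  move: YA; rewrite subsetD1 => /andP[YA aY].
  rewrite -(leq_add2l #|[set t]|) {1}cards1 add1n.
  apply: leq_trans (leq_card_setU _ _).
  apply: leq_trans (subset_leq_card (bigcup_subU _ _ _)).
  rewrite ltnNge; apply/negP => tightY; apply: noX; exists Y; split=> //.
  by apply: contraNneq aY => ->.
have ft x : x \in A -> x != a -> f x \in N x :\: [set t].
  by move=> Ax xa; apply: fN; rewrite !inE xa.
exists (fun x => if x == a then t else f x) => [x y Ax Ay|x Ax].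
  have [->|xa] := eqVneq x a; have [->|ya] := eqVneq y a => //.
  - by move=> tf; move: (ft _ Ay ya); rewrite -tf !inE eqxx.
  - by move=> tf; move: (ft _ Ax xa); rewrite tf !inE eqxx.
  - by apply: finj; rewrite !inE ?xa ?ya.
have [->//|xa] := eqVneq x a.
by have := ft _ Ax xa; rewrite inE => /andP[].
Qed.

End Hall.

(** * Finite rank in finitary matroids *)

Section Rank.
Local Open Scope classical_set_scope.
Local Open Scope card_scope.
Context {E : Type} {I : set (set E)} (mI : independence_structure I).
Implicit Types (A B C F H J : set E) (x : E) (n m k : nat).

(** The rank as a natural number, for sets of finite rank.  It is a relation
    because the rank of A may be infinite. *)
Definition has_rank A n := exists2 B, basis I A B & B #= `I_n.

(** A subset of J with n + 1 elements would augment a basis of A with n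
    elements, against its maximality; an infinite J would have such subsets. *)
Lemma has_rank_finite A n : has_rank A n ->
  forall J, J `<=` A -> I J -> exists2 k, k <= n & J #= `I_k.
Proof.
move=> [B [BA IB maxB] Bn] J JA IJ.
have noJ : ~ (`I_n.+1 #<= J).
  move=> /card_le_subset[C CJ Cn].
  have [x [Cx Bx] IxB] := indep_augment mI IB (indep_subset mI IJ CJ) Bn Cn.
  apply: Bx; rewrite -(maxB (x |` B)) //; first by left.
  by move=> y [->|/BA//]; exact/JA/CJ.
have [/finite_setP[k Jk]|/infinite_card_le] :=
  pselect (finite_set J); last first.
  by move=> /(_ n.+1) /noJ.
exists k => //; rewrite leqNgt; apply/negP => nk; apply: noJ.
by rewrite (card_le_eqr Jk) card_le_II.
Qed.

Lemma basis_card A B n : has_rank A n -> basis I A B -> B #= `I_n.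
Proof.
move=> An Bb; have [BA IB _] := Bb.
have [k kn Bk] := has_rank_finite An BA IB.
have [C [CA IC _] Cn] := An.
have [|m mk Cm] := has_rank_finite _ CA IC (n := k); first by exists B.
suff <- : k = n by [].
apply/eqP; rewrite eqn_leq kn/=; suff <- : m = n by [].
by apply/card_eq_II; rewrite -(card_eql Cm).
Qed.

Lemma has_rank_uniq A n m : has_rank A n -> has_rank A m -> n = m.
Proof.
move=> An [B Bb Bm]; apply/card_eq_II.
by rewrite -(card_eql (basis_card An Bb)).
Qed.

Lemma indep_basis A J n : has_rank A n -> J `<=` A -> I J -> J #= `I_n ->
  basis I A J.
Proof.
move=> An JA IJ Jn; split=> // C IC CA JC.
have [k kn Ck] := has_rank_finite An CA IC.
have nk := card_subset_leq JC Jn Ck.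
have kE : k = n by apply/eqP; rewrite eqn_leq kn nk.
by rewrite (card_subset_eq JC Jn) // -kE.
Qed.

Lemma basis_extend A J n : has_rank A n -> J `<=` A -> I J ->
  exists2 B, basis I A B & J `<=` B.
Proof.
move=> An JA IJ; have [k kn Jk] := has_rank_finite An JA IJ.
elim: {k}(n - k) {-2}k (erefl (n - k)) kn J JA IJ Jk
    => [|d IHd] k dE kn J JA IJ Jk.
  exists J => //; apply: indep_basis An _ _ _ => //.
  by have -> : n = k by apply/eqP; rewrite eqn_leq kn -subn_eq0 dE.
have kltn : k < n by rewrite -subn_gt0 dE.
have [B [BA IB _] Bn] := An.
have [C CB Ck] : exists2 C, C `<=` B & C #= `I_k.+1.
  by apply: card_le_subset; rewrite (card_le_eqr Bn) card_le_II.
have [x [Cx Jx] IxJ] := indep_augment mI IJ (indep_subset mI IB CB) Jk Ck.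
have [|||||D] := IHd k.+1 _ _ (x |` J) => //.
- by rewrite subnS dE.
- by move=> y [->|/JA//]; exact/BA/CB.
- exact: card_setU1.
- by move=> bD JD; exists D => // y Jy; apply: JD; right.
Qed.

Lemma sub_has_rank A B n : A `<=` B -> has_rank B n ->
  exists2 k, k <= n & has_rank A k.
Proof.
move=> AB Bn; have bA := basis_rank A mI; have [RA IR _] := bA.
have [k kn Rk] := has_rank_finite Bn (subset_trans RA AB) IR.
by exists k => //; exists (rank I A).
Qed.

Lemma indep_card_leq A J n k : has_rank A n -> J `<=` A -> I J -> J #= `I_k ->
  k <= n.
Proof.
move=> An JA IJ Jk; have [m mn Jm] := has_rank_finite An JA IJ.
by have -> : k = m by apply/card_eq_II; rewrite -(card_eql Jk).
Qed.

Lemma rank_card A n : has_rank A n -> rank I A #= `I_n.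
Proof. by move=> An; apply: basis_card An (basis_rank A mI). Qed.

Lemma card_has_rank A n : rank I A #= `I_n -> has_rank A n.
Proof. by exists (rank I A) => //; exact: basis_rank. Qed.

Lemma finite_rankP A : finite_rank I A <-> exists n, has_rank A n.
Proof.
split=> [/finite_setP[n /card_has_rank An]|[n /rank_card An]].
  by exists n.
by apply/finite_setP; exists n.
Qed.

Lemma sub_closure A : A `<=` closure I A.
Proof. by move=> x Ax; left. Qed.

Lemma closure_mono A B : A `<=` B -> closure I A `<=` closure I B.
Proof.
move=> AB x [/AB|[_ [C [CA IC IxC]]]]; first by left.
have [Bx|Bx] := pselect (B x); [by left | right; split=> //].
by exists C; split=> //; exact: subset_trans CA AB.
Qed.

Lemma closure_sub_flat A F : flat I F -> A `<=` F -> closure I A `<=` F.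
Proof. by move=> fF /closure_mono; rewrite fF. Qed.

(** The form in which the definition of dependence serves to enlarge
    independent sets. *)
Lemma indep_setU1 F J x : ~ closure I F x -> J `<=` F -> I J -> I (x |` J).
Proof.
move=> Fx JF IJ; apply: contrapT => IxJ; apply: Fx.
have [Fx|Fx] := pselect (F x); first by left.
by right; split=> //; exists J.
Qed.

Lemma flatI A B : flat I A -> flat I B -> flat I (A `&` B).
Proof.
move=> fA fB; apply/seteqP; split; last exact: sub_closure.
by move=> x ABx; split; [rewrite -fA|rewrite -fB];
  apply: closure_mono ABx => y [].
Qed.

(** If B could be enlarged by a point x of the closure, some independent D
    inside A would become dependent when x is added; completing D to a basis of
    A and augmenting it from x |` B yields a point of B, against the maximality
    of that basis. *)
Lemma basis_closure A B n : has_rank A n -> basis I A B ->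
  basis I (closure I A) B.
Proof.
move=> An bB; have [BA IB maxB] := bB.
split=> // [|C IC CA BC]; first exact: subset_trans BA (@sub_closure A).
apply/seteqP; split=> // x Cx; apply: contrapT => Bx.
have IxB : I (x |` B) by apply: (indep_subset mI IC) => y [->|/BC].
have [Ax|[Ax [D [DA ID IxD]]]] := CA _ Cx.
  apply: Bx; rewrite -(maxB (x |` B)) //; first by left.
  by move=> y [->|/BA].
have [D' bD' DD'] := basis_extend An DA ID; have [D'A ID' maxD'] := bD'.
have [y [xBy Dy] IyD] := indep_augment mI ID' IxB (basis_card An bD')
  (card_setU1 Bx (basis_card An bB)).
case: xBy IyD => [->|By] IyD.
  by apply: IxD; apply: (indep_subset mI IyD) => z [->|/DD']; [left|right].
apply: Dy; rewrite -(maxD' (y |` D')) //; first by left.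
by move=> z [->|/D'A//]; exact: BA.
Qed.

Lemma has_rank_closure A n : has_rank A n -> has_rank (closure I A) n.
Proof.
by move=> An; have [B bB Bn] := An; exists B => //; exact: basis_closure An bB.
Qed.

Lemma flat_closure A n : has_rank A n -> flat I (closure I A).
Proof.
move=> An; have [B bB Bn] := An; have [BA IB _] := bB.
apply/seteqP; split; last exact: sub_closure.
move=> x clx; apply: contrapT => Ax.
have [_ _ maxB] := basis_closure (has_rank_closure An) (basis_closure An bB).
have Bx : ~ B x by move=> /BA ?; apply: Ax; exact: sub_closure.
apply: Bx; rewrite -(maxB (x |` B)); first by left.
- exact: indep_setU1 Ax BA IB.
- by move=> y [->//|/BA Ay]; do 2 apply: sub_closure.
- by move=> y; right.
Qed.

Lemma has_rank_indep J k : I J -> J #= `I_k -> has_rank J k.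
Proof.
by move=> IJ Jk; exists J => //; split=> // C _ CJ JC; apply/seteqP.
Qed.

Lemma flat_rank_lt F A n m x : flat I F -> has_rank F n -> has_rank A m ->
  F `<=` A -> A x -> ~ F x -> n < m.
Proof.
move=> fF [B [BF IB _] Bn] Am FA Ax Fx.
apply: (@indep_card_leq A (x |` B)) => //.
- by move=> y [->|/BF/FA].
- by apply: indep_setU1 BF IB; rewrite fF.
- by apply: card_setU1 Bn => /BF.
Qed.

Lemma modular_has_rank A B a b u i : modular I -> flat I A -> flat I B ->
  has_rank A a -> has_rank B b -> has_rank (A `|` B) u ->
  has_rank (A `&` B) i -> a + b = u + i.
Proof.
move=> modI fA fB /rank_card Aa /rank_card Bb /rank_card ABu /rank_card ABi.
apply/card_eq_II; rewrite -(card_eql (card_add_II Aa Bb)).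
by rewrite (card_eql (modI _ _ fA fB)) (card_add_II ABu ABi).
Qed.

(** The rank of the ground set may be infinite, so the comparison is made
    between cardinals; an independent set larger than rho(H) is enough. *)
Lemma rank_lt_setT H J k : has_rank H k -> I J -> J #= `I_k.+1 ->
  card_lt (rank I H) (rank I setT).
Proof.
move=> /rank_card Hk IJ Jk.
rewrite /card_lt (card_le_eql Hk) (card_le_eqr Hk).
have [/finite_setP[m Tm]|Tinf] := pselect (finite_set (rank I setT)).
  have km : k.+1 <= m.
    by apply: (indep_card_leq (card_has_rank Tm)) IJ Jk.
  rewrite (card_le_eqr Tm) (card_le_eql Tm) !card_le_II (ltnW km).
  by split=> //; apply/negP; rewrite -ltnNge.
split; first exact: infinite_card_le.
by move=> /card_le_finite fT; apply: Tinf; apply: fT; exact: finite_II.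
Qed.

Lemma rank_lt_ex H k : has_rank H k -> card_lt (rank I H) (rank I setT) ->
  exists x, ~ closure I H x.
Proof.
move=> Hk [_ nTH]; apply: contrapT => /forallNP clH; apply: nTH.
have clT : closure I H = setT.
  by apply/seteqP; split=> // x _; exact: contrapT (clH x).
have := rank_card (has_rank_closure Hk); rewrite clT => Tk.
by rewrite (card_le_eql Tk) (card_le_eqr (rank_card Hk)).
Qed.

End Rank.

Arguments has_rank {E} I A n.

(** * Translations in independence groups *)

Section Group.
Local Open Scope classical_set_scope.
Local Open Scope card_scope.
Local Open Scope group_scope.
Context {G : groupType} {I : set (set G)} (GI : independence_group I).
Let mI := independence_group_structure GI.
Implicit Types (A B F V W : set G) (g : G).

Lemma indep_preimage g A : I ([set x | A (g * x)]) <-> I A.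
Proof.
rewrite -(independence_group_translate GI g).
suff -> : [set g * x | x in [set x | A (g * x)]] = A by [].
apply/seteqP; split=> [_ [x Agx <-]//|x Ax].
by exists (g^-1 * x); rewrite /= mulVKg.
Qed.

(** Translates are written as preimages: [[set x | F (g * x)]] is g^-1 F. *)
Lemma flat_preimage g F : flat I F -> flat I [set x | F (g * x)].
Proof.
move=> fF; apply/seteqP; split; last exact: sub_closure.
move=> x [//|[Fgx [D [DF ID IxD]]]] /=; rewrite -fF; right; split=> //.
exists [set y | D (g^-1 * y)]; split=> [y /DF/=||].
- by rewrite mulVKg.
- by apply/indep_preimage.
move=> /(indep_preimage g _).2 IgD; apply: IxD; apply: (indep_subset mI IgD).
by move=> y [->|Dy]; [left|right; rewrite /= mulKg].
Qed.

Lemma has_rank_preimage g F n : has_rank I F n ->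
  has_rank I [set x | F (g * x)] n.
Proof.
move=> [B [BF IB maxB] Bn]; exists [set x | B (g * x)].
  split=> [x /BF//||C IC CF BC]; first exact/indep_preimage.
  rewrite -(maxB [set x | C (g^-1 * x)]) /=.
  - by apply/seteqP; split=> x /=; rewrite mulKg.
  - exact/indep_preimage.
  - by move=> x /CF/=; rewrite mulVKg.
  - by move=> x Bx; apply: BC; rewrite /= mulVKg.
have BE : B = [set g * x | x in [set x | B (g * x)]].
  apply/seteqP; split=> [x Bx|_ [x Bx <-]//].
  by exists (g^-1 * x); rewrite /= mulVKg.
rewrite -(card_eqr Bn) [X in _ #= X]BE card_eq_sym inj_card_eq // => x y _ _.
exact: mulgI.
Qed.

(** The set of all x with g x in F is a flat containing A.  This is how
    inclusions of products of sets pass to products of closures, one factor at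
    a time. *)
Lemma closure_mul_sub g A F : flat I F -> (forall x, A x -> F (g * x)) ->
  forall x, closure I A x -> F (g * x).
Proof. by move=> /(flat_preimage g) fF AF; apply: closure_sub_flat fF AF. Qed.

(** Singletons are translates of each other, so they are all independent as soon
    as one of them is. *)
Lemma indep_set1 A n x : has_rank I A n -> 0 < n -> I [set x].
Proof.
move=> [B [_ IB _]]; case: n => // n /eq_cardSP[y By _] _.
have Iy : I [set y] by apply: (indep_subset mI IB) => _ ->.
have := (indep_preimage (y * x^-1) [set y]).2 Iy; congr I.
apply/seteqP; split=> z /=; last by move=> ->; rewrite mulgVK.
by move=> /(canRL (mulKg _)) ->; rewrite invgM invgK mulgVK.
Qed.

End Group.

(** * Products of flats and matchings *)

Section Matching.
Local Open Scope classical_set_scope.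
Local Open Scope card_scope.
Local Open Scope group_scope.
Context {G : groupType} {I : set (set G)} (GI : independence_group I).
Context (modI : modular I) (mulGC : forall x y : G, x * y = y * x).
Let mI := independence_group_structure GI.
Implicit Types (A B F V W H : set G) (g : G).

Lemma submonoidP H :
  submonoid H <-> H 1 /\ forall x y, H x -> H y -> H (x * y).
Proof.
split=> -[H1 HM]; split.
- by move: H1; rewrite inE.
- by move=> x y Hx Hy; have := HM x y; rewrite !inE; apply.
- by rewrite inE.
- by move=> x y; rewrite !inE; exact: HM.
Qed.

(** An analogue of the Cauchy-Davenport inequality, by induction on the rank of
    W with Dyson's e-transform. *)
Lemma product_rank_leq A n : has_rank I A n -> flat I A ->
  (forall H k, submonoid H -> has_rank I H k -> k <= n -> k <= 1) ->
  forall V W s t, flat I V -> flat I W -> V !=set0 -> W 1 ->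
    (forall v w, V v -> W w -> A (v * w)) ->
    has_rank I V s -> has_rank I W t -> s + t <= n.+1.
Proof.
move=> An fA noH V W s t; have [m] := ubnP t.
elim: m => // m IHm in V W s t *; rewrite ltnS => tm fV fW V0 W1 VWA Vs Wt.
have VA : V `<=` A by move=> v Vv; rewrite -[v]mulg1; exact: VWA.
have [s' s'n Vs'] := sub_has_rank mI VA An.
have sn : s <= n by rewrite (has_rank_uniq mI Vs Vs').
have [t1|t1] := leqP t 1; first by rewrite -addn1 leq_add.
have [[e [w [Ve Ww Vew]]]|VW] :=
  pselect (exists e w, [/\ V e, W w & ~ V (e * w)]).
(* The e-transform of (V, W) is (closure I (V `|` eW), W'). *)
- pose eW := [set x | W (e^-1 * x)]; pose W' := W `&` [set x | V (e * x)].
  have feW : flat I eW by exact: flat_preimage.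
  have fW' : flat I W' by apply: flatI => //; exact: flat_preimage.
  have UA : V `|` eW `<=` A.
    by move=> x [/VA//|eWx]; rewrite -(mulVKg e x); exact: VWA.
  have [u un Uu] := sub_has_rank mI UA An.
  have [i it W'i] := sub_has_rank mI (@subIsetl _ W [set x | V (e * x)]) Wt.
  have it' : i < t.
    apply: (flat_rank_lt mI fW' W'i Wt _ Ww); first by move=> x [].
    by move=> [_ /Vew].
  have VeWi : has_rank I (V `&` eW) i.
    have := has_rank_preimage GI e^-1 W'i; congr has_rank.
    by apply/seteqP; split=> x /=; rewrite /eW /= mulVKg => -[].
  have eWt : has_rank I eW t by exact: has_rank_preimage.
  rewrite (modular_has_rank mI modI fV feW Vs eWt Uu VeWi).
  apply: (IHm (closure I (V `|` eW)) W') => //.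
  - exact: leq_trans it' tm.
  - exact: flat_closure Uu.
  - by exists e; apply: sub_closure; left.
  - by split=> //=; rewrite mulg1.
  - move=> v x clv [Wx Vex]; rewrite mulGC.
    apply: (closure_mul_sub GI fA) clv => y [Vy|eWy]; rewrite mulGC.
      exact: VWA.
    rewrite -(mulVKg e y) -mulgA (mulGC _ x) mulgA; exact: VWA.
  - exact: has_rank_closure.
(* Now V W is contained in V, and the stabilizer H of V contains W. *)
- have [v0 Vv0] := V0.
  pose H := [set h | forall v, V v -> V (v * h)].
  have subH : submonoid H.
    apply/submonoidP; split=> [v|x y Hx Hy v Vv]; first by rewrite mulg1.
    by rewrite mulgA; exact/Hy/Hx.
  have WH : W `<=` H.
    move=> w Ww v Vv; apply: contrapT => Vvw; apply: VW; by exists v, w.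
  have HV : H `<=` [set x | V (v0 * x)] by move=> h; exact.
  have [k ks Hk] := sub_has_rank mI HV (has_rank_preimage GI v0 Vs).
  have [t' t'k Wt'] := sub_has_rank mI WH Hk.
  have tk : t <= k by rewrite (has_rank_uniq mI Wt Wt').
  have := noH H k subH Hk (leq_trans ks sn).
  by rewrite leqNgt (leq_trans t1 tk).
Qed.

(** Hall's condition for a set X of elements of bA is [product_rank_leq] for the
    closure of X and the closure of 1 together with the elements of bB to which
    no element of X may be matched. *)
Lemma matched_of_no_submonoid A B n :
  (forall H k, submonoid H -> has_rank I H k -> k <= n -> k <= 1) ->
  flat I A -> flat I B -> has_rank I A n -> has_rank I B n -> ~ B 1 ->
  matched I A B.
Proof.
move=> noH fA fB An Bn B1 bA bB bbA bbB.
have [bAA IbA _] := bbA; have [bBB IbB _] := bbB.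
have [a ainj aE] := enum_card_II (basis_card mI An bbA).
have [b binj bE] := enum_card_II (basis_card mI Bn bbB).
have bAa i : bA (a i) by rewrite -aE; exists i.
have bBb i : bB (b i) by rewrite -bE; exists i.
pose N (i : 'I_n) : {set 'I_n} := finset (fun j => ~~ `[< A (a i * b j) >]).
have [X _|s sinj sN] := @hall_marriage _ _ N id [set: 'I_n]%SET.
- have [->|[i0 Xi0]] := finset.set_0Vmem X; first by rewrite cards0.
  (* NX indexes the y in bB such that x y is in A for all x in a @` X. *)
  pose NX : {set 'I_n} := finset.setC (\bigcup_(i in X) N i)%SET.
  pose V := closure I (a @` [set` X]).
  pose T := 1 |` (b @` [set` NX]).
  have aXA : a @` [set` X] `<=` bA by move=> _ [i _ <-].
  have bNB : b @` [set` NX] `<=` bB by move=> _ [i _ <-].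
  have aXr : has_rank I (a @` [set` X]) #|X|.
    apply: has_rank_indep (card_image_finset _ ainj).
    exact: (indep_subset mI IbA).
  have Tr : has_rank I T #|NX|.+1.
    apply: has_rank_indep.
      apply: (indep_setU1 (F := B)); first by rewrite fB.
        exact: subset_trans bNB bBB.
      exact: (indep_subset mI IbB).
    apply: card_setU1; last exact: card_image_finset.
    by move=> /bNB/bBB.
  rewrite -(leq_add2r #|NX|) cardsC card_ord -ltnS -addnS.
  apply: (product_rank_leq An fA noH (V := V) (W := closure I T)).
  + exact: flat_closure aXr.
  + exact: flat_closure Tr.
  + by exists (a i0); apply: sub_closure; exists i0.
  + by apply: sub_closure; left.
  + move=> v w clv clw; apply: (closure_mul_sub GI fA) clw => y Ty.
    rewrite mulGC; apply: (closure_mul_sub GI fA) clv => x [i Xi <-].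
    rewrite mulGC; case: Ty => [->|[j /= NXj <-]].
      by rewrite mulg1; exact: bAA.
    apply: contrapT => Aij; move: NXj; rewrite inE => /bigcupP; apply.
    by exists i => //; rewrite inE; apply/asboolP.
  + exact: has_rank_closure.
  + exact: has_rank_closure.
have {}sinj : injective s by move=> i j; apply: sinj; rewrite inE.
pose f x := if [pick i | a i == x] is Some i then b (s i) else 1.
have fa i : f (a i) = b (s i).
  rewrite /f; case: pickP => [j /eqP/ainj->//|/(_ i)]; by rewrite eqxx.
(* Only the values of f on bA matter; 1 is a filler. *)
exists f; last first.
  move=> x; rewrite -aE => -[i _ <-]; rewrite fa.
  by have := sN i (finset.in_setT i); rewrite inE => /asboolP.
rewrite -aE; split.
- by move=> _ [i _ <-]; rewrite fa.
- move=> x y; rewrite !inE => -[i _ <-] [j _ <-]; rewrite !fa.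
  by move=> /binj/sinj->.
- move=> y; rewrite -bE => -[j _ <-]; exists (a (invF sinj j)).
    by exists (invF sinj j).
  by rewrite fa f_invF.
Qed.

(** With C the closure of H and D a basis of H containing 1, replacing 1 in D by
    a point g outside C spans a flat B of the same rank without 1.  No a in C
    can be matched to an element c <> 1 of D, since a c stays in C. *)
Lemma no_matching_of_submonoid H : submonoid H -> card_lt `I_1 (rank I H) ->
  card_lt (rank I H) (rank I setT) -> finite_rank I H -> ~ matching_property I.
Proof.
move=> /submonoidP[H1 HM] [_ gt1H] ltHT /(finite_rankP mI)[n Hn] matchI.
have n1 : 1 < n.
  rewrite ltnNge; apply/negP => n1; apply: gt1H.
  by rewrite (card_le_eql (rank_card mI Hn)) card_le_II.
have [g Hg] := rank_lt_ex mI Hn ltHT.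
pose C := closure I H.
have fC : flat I C by exact: flat_closure Hn.
have Cn : has_rank I C n by exact: has_rank_closure.
have CM x y : C x -> C y -> C (x * y).
  move=> Cx; apply: closure_mul_sub => // {}y Hy; rewrite mulGC.
  by apply: (closure_mul_sub GI fC) Cx => {}x Hx; apply: sub_closure; exact: HM.
have [D bD D1] : exists2 D, basis I H D & [set 1] `<=` D.
  apply: (basis_extend mI Hn); first by move=> _ ->.
  exact: (indep_set1 GI _ Hn (ltnW n1)).
have [DH ID _] := bD; have Dn := basis_card mI Hn bD.
pose K := D `\ 1.
have Kn : K #= `I_n.-1.
  have /finite_setP[k Kk] : finite_set K.
    by apply: finite_setD; apply/finite_setP; exists n.
  have := card_setU1 (A := K) (x := 1) _ Kk.
  rewrite setD1K; last exact: D1.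
  rewrite (card_eql Dn) => kn.
  by rewrite (card_eq_II (kn _)) // => -[_ /(_ erefl)].
have IgD : I (g |` D) by exact: indep_setU1 Hg DH ID.
have gD : ~ D g by move=> /DH Hg'; apply: Hg; exact: sub_closure.
pose L := g |` K.
have Ln : L #= `I_n.
  rewrite -(prednK (ltnW n1)); by apply: card_setU1 Kn => -[/gD].
have IL : I L.
  by apply: (indep_subset mI IgD) => x [->|[Dx _]]; [left|right].
have Lr := has_rank_indep IL Ln.
pose B := closure I L.
have Br : has_rank I B n by exact: has_rank_closure.
have bL : basis I B L.
  by apply: (indep_basis mI Br) => //; exact: sub_closure.
have B1 : ~ B 1.
  move=> B1; have gDB : g |` D `<=` B.
    move=> x [->|Dx]; first by apply: sub_closure; left.
    have [->//|x1] := pselect (x = 1).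
    by apply: sub_closure; right.
  have := indep_card_leq mI Br gDB IgD (card_setU1 gD Dn).
  by rewrite ltnn.
have rankCB : rank I C #= rank I B.
  by rewrite (card_eql (rank_card mI Cn)) card_eq_sym (rank_card mI Br).
have [f [_ _ fsurj] fC'] : exists2 f : G -> G, set_bij D L f &
    forall a, D a -> ~ C (a * f a).
  apply: (matchI C B) => //.
  - exact: flat_closure Lr.
  - by apply/(finite_rankP mI); exists n.
  - by apply/(finite_rankP mI); exists n.
  - exact: basis_closure Hn bD.
have [c Kc _] : exists2 x, K x & K `\ x #= `I_n.-2.
  by apply/eq_cardSP; case: n n1 Kn {Hn Cn Dn Ln Lr Br} => [|[]].
have [a Da fac] : (f @` D) c by apply: fsurj; right.
apply: (fC' a Da); rewrite fac; apply: CM; apply: sub_closure.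
  exact: DH.
by case: Kc => /DH.
Qed.

End Matching.

Theorem theorem7p5 (G : groupType) (I : set (set G)) :
  modular_abelian_independence_group I ->
  matching_property I <->
  ~ exists H : set G,
      [/\ submonoid H, card_lt `I_1 (rank I H),
          card_lt (rank I H) (rank I setT) & finite_rank I H].
Proof.
move=> [GI modI mulGC]; have mI := independence_group_structure GI.
split=> [matchI [H [subH lt1H ltHT fH]]|noH A B fA fB rA rB rAB B1].
  exact: (no_matching_of_submonoid GI mulGC subH lt1H ltHT fH).
have [n An] := (finite_rankP mI A).1 rA.
have Bn : has_rank I B n.
  by apply: card_has_rank => //; rewrite -(card_eql rAB) rank_card.
apply: (matched_of_no_submonoid GI modI mulGC _ fA fB An Bn B1).
move=> H k subH Hk kn.
rewrite leqNgt; apply/negP => k1; apply: noH; exists H; split=> //.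
- have Hkc := rank_card mI Hk.
  rewrite /card_lt (card_le_eql Hkc) (card_le_eqr Hkc).
  by rewrite !card_le_II ltnW //; split=> //; apply/negP; rewrite -ltnNge.
- have [bB bbB Bbn] := Bn; have [BB IB _] := bbB.
  (* 1 |` bB has n + 1 > k elements, hence rho(H) < rho(G). *)
  have I1 : I (1%g |` bB)%classic.
    by apply: (indep_setU1 (F := B)) => //; rewrite fB.
  have [C C1 Ck] : exists2 C, (C `<=` 1%g |` bB)%classic & (C #= `I_k.+1)%card.
    apply: card_le_subset.
    rewrite (card_le_eqr (card_setU1 _ Bbn)) ?card_le_II // => /BB.
    exact: B1.
  have IC := indep_subset mI I1 C1.
  exact: (rank_lt_setT mI Hk IC Ck).
- by apply/(finite_rankP mI); exists k.
Qed.
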